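(* Let $p\ge1$ and $\Gamma=\{(s,|s|^p):s\in\mathbb{R}\}$. There exists a set $E\subset[-\pi/2,\pi/2)^2$ of positive Lebesgue measure such that for every $(\theta_1,\theta_2)\in E$, $(\Gamma,\ell_{\theta_1}\cup\ell_{\theta_2})$ is a Heisenberg Uniqueness Pair.
   Context: For a finite complex Borel measure $\mu$ on $\mathbb{R}^2$, $\widehat{\mu}(x,y)=\int_{\mathbb{R}^2}e^{-i(xs+yt)}\,d\mu(s,t)$. For an angle $\theta$, $\ell_\theta=\{t(\cos\theta,\sin\theta):t\in\mathbb{R}\}$. $\mathcal{AC}(\Gamma)$ is the set of finite complex measures supported on $\Gamma$ and absolutely continuous with respect to arc length on $\Gamma$. For $\Lambda\subset\mathbb{R}^2$, $(\Gamma,\Lambda)$ is a Heisenberg Uniqueness Pair if every $\mu\in\mathcal{AC}(\Gamma)$ with $\widehat{\mu}=0$ on $\Lambda$ satisfies $\mu=0$. *)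

(* Defs.v *)
From HB Require Import structures.
From mathcomp Require Import all_boot all_order all_algebra.
From mathcomp Require Import all_classical all_reals all_analysis.
Set Implicit Arguments. Unset Strict Implicit. Unset Printing Implicit Defensive.
Import Order.TTheory GRing.Theory Num.Theory numFieldNormedType.Exports.
Local Open Scope classical_set_scope.
Local Open Scope ring_scope.

Definition gam {R : realType} (p s : R) : R := `|s| `^ p.

(* Arc-length density along the parametrization s |-> (s, |s|^p):
   d(arc length) = sqrt(1 + (d/ds |s|^p)^2) ds, and |d/ds |s|^p| = p |s|^(p-1)
   (for s <> 0; the value at s = 0 is irrelevant, a null set). *)
Definition arcw {R : realType} (p s : R) : R :=
  Num.sqrt (1 + (p * `|s| `^ (p - 1)) ^+ 2).

(* A measure mu in AC(Gamma) is mu = f dsigma, sigma = arc length on Gamma,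
   with f in L^1(sigma) complex valued.  We encode f(s,|s|^p) = u s + i v s.
   mu finite  <=>  u, v integrable w.r.t. sigma, i.e. u*arcw, v*arcw are
   Lebesgue integrable on R. *)
Definition AC_density {R : realType} (p : R) (u v : R -> R) : Prop :=
  (@lebesgue_measure R).-integrable setT (fun s => (u s * arcw p s)%:E) /\
  (@lebesgue_measure R).-integrable setT (fun s => (v s * arcw p s)%:E).

(* Fourier transform  mu^(x,y) = int e^{-i(x s + y |s|^p)} (u s + i v s) dsigma(s),
   split into real and imaginary parts. *)
Definition FT_re {R : realType} (p : R) (u v : R -> R) (x y : R) : R :=
  Rintegral (@lebesgue_measure R) setT
    (fun s => (cos (x * s + y * gam p s) * u s + sin (x * s + y * gam p s) * v s)
              * arcw p s).
Definition FT_im {R : realType} (p : R) (u v : R -> R) (x y : R) : R :=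
  Rintegral (@lebesgue_measure R) setT
    (fun s => (cos (x * s + y * gam p s) * v s - sin (x * s + y * gam p s) * u s)
              * arcw p s).

Definition FT_zero {R : realType} (p : R) (u v : R -> R) (x y : R) : Prop :=
  FT_re p u v x y = 0 /\ FT_im p u v x y = 0.

Definition two_lines {R : realType} (th1 th2 : R) : set (R * R) :=
  [set xy | exists t : R, xy = (t * cos th1, t * sin th1) \/
                          xy = (t * cos th2, t * sin th2)].

(* (Gamma, Lambda) is a Heisenberg uniqueness pair.  mu = 0 means f = 0
   sigma-a.e., i.e. (arcw > 0) u = v = 0 Lebesgue-a.e. in s. *)
Definition HUP_Gamma {R : realType} (p : R) (Lam : set (R * R)) : Prop :=
  forall u v : R -> R, AC_density p u v ->
    (forall xy, Lam xy -> FT_zero p u v xy.1 xy.2) ->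
    {ae (@lebesgue_measure R), forall s, u s = 0 /\ v s = 0}.

(* Main.v *)
(* Restricting the transform to the line of angle [th] gives the Fourier transform
   of the push-forward of [g ds] by [phase s = cos th * s + sin th * |s|^p]. If it
   vanishes, so does the integral of [g * sg (phase - y)] for every [y].

   For [p > 1] and [0 < th < pi/2] the phase decreases to its vertex and increases
   afterwards, so the primitive of [g] takes equal values at any two points with
   the same phase. Two angles give two such reflections with different vertices.
   Composing them suitably moves a point to the right, without fixed points. The
   primitive is continuous and tends to 0 at infinity, so it vanishes, and [g = 0]
   a.e. by Lebesgue differentiation. For [p = 1] and [tan th1 < 1] the first phase
   is increasing and a single line suffices. *)

Require Import Defs.
From HB Require Import structures.
From mathcomp Require Import all_boot all_order all_algebra.
From mathcomp Require Import all_classical all_reals all_analysis.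
From mathcomp Require Import measurable_realfun ring lra.
Import Order.TTheory GRing.Theory Num.Theory numFieldNormedType.Exports.
Local Open Scope classical_set_scope.
Local Open Scope ring_scope.

(** * Pairings of an integrable function with bounded multipliers *)

Section Pairing.
Context {R : realType}.
Notation mu := (@lebesgue_measure R).
Implicit Types (f g h : R -> R).

Definition bounded_measurable h :=
  measurable_fun setT h /\ exists M : R, forall x, `|h x| <= M.

Lemma bounded_measurableZ h k :
  bounded_measurable h -> bounded_measurable (fun s => k * h s).
Proof.
move=> [mh [M hM]]; split; first exact: (measurable_funM (measurable_cst k) mh).
by exists (`|k| * M) => s; rewrite normrM ler_wpM2l.
Qed.

Lemma bounded_measurableD h1 h2 : bounded_measurable h1 ->
  bounded_measurable h2 -> bounded_measurable (fun s => h1 s + h2 s).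
Proof.
move=> [m1 [M1 h1M]] [m2 [M2 h2M]]; split; first exact: measurable_funD.
by exists (M1 + M2) => s; apply: le_trans (ler_normD _ _) (lerD _ _).
Qed.

Definition pairing g h : R := \int[mu]_s (h s * g s).

Lemma integrable_pairing g h : mu.-integrable setT (EFin \o g) ->
  bounded_measurable h -> mu.-integrable setT (EFin \o (fun s => h s * g s)).
Proof.
move=> ig [mh [M hM]].
have := @integrableMr _ _ _ mu _ measurableT h _ mh _ ig.
apply; exists M; split; first exact: num_real.
by move=> x Mx y _; apply: le_trans (hM y) (ltW Mx).
Qed.

Lemma pairingD g h1 h2 : mu.-integrable setT (EFin \o g) ->
  bounded_measurable h1 -> bounded_measurable h2 ->
  pairing g (fun s => h1 s + h2 s) = pairing g h1 + pairing g h2.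
Proof.
move=> ig b1 b2; rewrite /pairing -RintegralD//; try exact: integrable_pairing.
by apply: eq_Rintegral => s _; rewrite mulrDl.
Qed.

Lemma pairingZ g h k : mu.-integrable setT (EFin \o g) ->
  bounded_measurable h -> pairing g (fun s => k * h s) = k * pairing g h.
Proof.
move=> ig bh; rewrite /pairing -RintegralZl//; last exact: integrable_pairing.
by apply: eq_Rintegral => s _; rewrite mulrA.
Qed.

(** Dominated convergence with majorant [|g|]. Convergence is asked only almost everywhere because
    [sg (s - x_n)] may fail to converge at the limit point of [x_n]. *)
Lemma pairing_cvg g (h_ : nat -> R -> R) h : mu.-integrable setT (EFin \o g) ->
  measurable_fun setT h -> (forall n, measurable_fun setT (h_ n)) ->
  (forall n s, `|h_ n s| <= 1) ->
  {ae mu, forall s, h_ ^~ s @ \oo --> h s} ->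
  pairing g (h_ n) @[n --> \oo] --> pairing g h.
Proof.
move=> ig mh mh_ h1 hcv.
have mg : measurable_fun setT g by apply/measurable_EFinP; case/integrableP: ig.
have [] // := @dominated_convergence _ _ _ mu _ measurableT
   (fun n s => (h_ n s * g s)%:E) (fun s => (h s * g s)%:E) (fun s => `|g s|%:E).
- move=> n. apply/measurable_EFinP. exact: (measurable_funM (mh_ n) mg).
- by apply/measurable_EFinP; exact: (measurable_funM mh mg).
- apply: (@filterS _ _ (ae_filter_ringOfSetsType mu)) hcv => s hs _.
  apply: cvg_EFin; first by apply: nearW.
  by apply: cvgM => //; exact: cvg_cst.
- by apply: integrable_norm.
- apply: aeW => s n _; rewrite /= lee_fin normrM.
  by rewrite -[leRHS]mul1r ler_wpM2r.
move=> int _ cv; rewrite /pairing /Rintegral; apply: fine_cvg.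
by rewrite fineK//; exact: integrable_fin_num.
Qed.

Lemma pairing_cvg0 g (h_ : nat -> R -> R) h : mu.-integrable setT (EFin \o g) ->
  measurable_fun setT h -> (forall n, measurable_fun setT (h_ n)) ->
  (forall n s, `|h_ n s| <= 1) -> (forall s, h_ ^~ s @ \oo --> h s) ->
  (forall n, pairing g (h_ n) = 0) -> pairing g h = 0.
Proof.
move=> ig mh mh_ h1 hcv h0.
have := pairing_cvg _ _ _ ig mh mh_ h1 (aeW mu hcv).
by under eq_fun do rewrite h0; move=> /(cvg_lim (@Rhausdorff R)) <-; rewrite lim_cst.
Qed.

Lemma measurable_sg : measurable_fun setT (Num.sg : R -> R).
Proof.
rewrite (_ : Num.sg = \1_(`]0, +oo[%classic : set R) \- \1_(`]-oo, 0[%classic : set R)).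
  by apply: measurable_funB; exact: measurable_indic.
apply/funext => x; rewrite /= !indicE !mem_setE !in_itv/= andbT.
by case: sgrP => x0 //=; rewrite ?subr0 ?sub0r.
Qed.

Lemma sg_le1 (x : R) : `|Num.sg x| <= 1.
Proof. by rewrite normr_sg; case: (x != 0). Qed.

End Pairing.

(** * Polynomial approximation of the sign *)

Section Sign.
Context {R : realType}.
Implicit Types (x : R).

(* Maps [-1, 1] to itself; its iterates converge pointwise to the sign there. *)
Definition smoothstep x : R := (3 * x - x ^+ 3) / 2.

Lemma iter_smoothstepN n x : iter n smoothstep (- x) = - iter n smoothstep x.
Proof. by elim: n => //= n ->; rewrite /smoothstep; ring. Qed.

(** The defect obeys [1 - smoothstep y = (1 - y) * ((1 - y) (2 + y) / 2)]. The iterates never drop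
    below [x], so the second factor is at most [1 - x / 2] and convergence is geometric. *)
Lemma iter_smoothstep_pos n x : 0 < x <= 1 ->
  x <= iter n smoothstep x <= 1 /\ 1 - iter n smoothstep x <= (1 - x / 2) ^+ n.
Proof.
move=> /andP[x0 x1]; elim: n => [|n [/andP[IH1 IH2] IH]] /=.
  by rewrite expr0 lexx x1; split => //; lra.
set y := iter n smoothstep x in IH1 IH2 IH *.
have e1 : 1 - smoothstep y = (1 - y) * ((1 - y) * (2 + y) / 2).
  by rewrite /smoothstep; field.
have e2 : (1 - y) * (2 + y) / 2 <= 1 - x / 2 by nra.
have e3 : smoothstep y - y = y * (1 - y ^+ 2) / 2 by rewrite /smoothstep; field.
have e4 : 0 <= y * (1 - y ^+ 2) by apply: mulr_ge0; nra.
have e5 : 0 <= (1 - y) * ((1 - y) * (2 + y) / 2) by apply: mulr_ge0; nra.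
split; first by apply/andP; split; lra.
rewrite e1 exprSr; apply: ler_pM => //; nra.
Qed.

Lemma iter_smoothstep_cvg x : `|x| <= 1 ->
  iter n smoothstep x @[n --> \oo] --> Num.sg x.
Proof.
have pos z : 0 < z <= 1 -> iter n smoothstep z @[n --> \oo] --> (1 : R).
  move=> z01; have /andP[z0 z1] := z01.
  have cv : (1 - (1 - z / 2) ^+ n) @[n --> \oo] --> (1 : R).
    rewrite -[X in _ --> X]subr0; apply: cvgB; first exact: cvg_cst.
    by apply: cvg_expr; rewrite ger0_norm; lra.
  have sq : \forall n \near \oo,
      1 - (1 - z / 2) ^+ n <= iter n smoothstep z <= 1.
    apply: nearW => n; have [/andP[_ ->] h] := iter_smoothstep_pos n _ z01.
    by rewrite andbT; lra.
  by apply: (squeeze_cvgr sq cv); exact: cvg_cst.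
rewrite ler_norml => /andP[xN1 x1]; case: (sgrP x) => x0.
- rewrite (_ : (fun n => _) = fun=> 0); first exact: cvg_cst.
  apply/funext => n; rewrite x0; elim: n => //= n ->; rewrite /smoothstep.
  by rewrite expr0n /= mulr0 subr0 mul0r.
- by apply: pos; rewrite x0.
- rewrite -[x]opprK; under eq_fun do rewrite iter_smoothstepN.
  by apply: cvgN; apply: pos; apply/andP; split; lra.
Qed.

Lemma iter_smoothstep_le1 n x : `|x| <= 1 -> `|iter n smoothstep x| <= 1.
Proof.
move=> x1; elim: n => //= n; set y := iter n _ _; rewrite !ler_norml /smoothstep.
move=> /andP[y1 y2].
(* The two products are [2 (1 - smoothstep y)] and [2 (1 + smoothstep y)]. *)
have e1 : 0 <= (1 - y) ^+ 2 * (2 + y) by rewrite mulr_ge0 ?sqr_ge0//; lra.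
have e2 : 0 <= (1 + y) ^+ 2 * (2 - y) by rewrite mulr_ge0 ?sqr_ge0//; lra.
by apply/andP; split; lra.
Qed.

Fixpoint smoothstep_poly n : {poly R} :=
  if n is m.+1 then 2^-1 *: (3 *: smoothstep_poly m - smoothstep_poly m ^+ 3)
  else 'X.

Lemma horner_smoothstep_poly n x : (smoothstep_poly n).[x] = iter n smoothstep x.
Proof.
elim: n => [|n IH] /=; first by rewrite hornerX.
by rewrite !hornerE IH /smoothstep mulrC.
Qed.

(** As soon as [|x| / (n + 1) < pi], the sine has the sign of [x]: the sequence is eventually
    constant. *)
Lemma sg_sin_div_cvg x : Num.sg (sin (n.+1%:R^-1 * x)) @[n --> \oo] --> Num.sg x.
Proof.
have cv : `|n.+1%:R^-1 * x| @[n --> \oo] --> (0 : R).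
  rewrite -[X in _ --> X](@normr0 _ R); apply: cvg_norm.
  rewrite -[X in _ --> X](mul0r x); apply: cvgMr_tmp.
  exact: cvg_harmonic.
apply: cvg_near_cst.
near=> n.
have lt_pi : `|n.+1%:R^-1 * x| < pi.
  near: n; apply: (cvgr_lt _ cv); exact: pi_gt0.
have n0 : 0 < n.+1%:R^-1 :> R by rewrite invr_gt0.
move: lt_pi; rewrite normrM (gtr0_norm n0).
case: (sgrP x) => x0 h.
- by rewrite x0 mulr0 sin0 sgr0.
- by rewrite gtr0_sg//; apply: sin_gt0_pi; rewrite mulr_gt0//= -(gtr0_norm x0).
- apply: ltr0_sg; rewrite -oppr_gt0 -sinN; apply: sin_gt0_pi.
  by rewrite -mulrN mulr_gt0 ?oppr_gt0//= -(ltr0_norm x0).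
Unshelve. all: by end_near. Qed.

End Sign.

(** * From a vanishing Fourier transform to vanishing sign pairings *)

Section FourierUniqueness.
Context {R : realType}.
Notation mu := (@lebesgue_measure R).
Variables g phi : R -> R.
Hypothesis ig : mu.-integrable setT (EFin \o g).
Hypothesis mphi : measurable_fun setT phi.
(** The free shift [k] covers cosines and sines at once and keeps product-to-sum formulas inside one
    family. *)
Hypothesis fourier0 : forall t k, pairing g (fun s => cos (t * phi s + k)) = 0.

Let measurable_affine t k : measurable_fun setT (fun s => t * phi s + k).
Proof.
by apply: measurable_funD => //; exact: (measurable_funM (measurable_cst t) mphi).
Qed.

Let measurable_sin_affine t k : measurable_fun setT (fun s => sin (t * phi s + k)).
Proof.
exact: (measurableT_comp (continuous_measurable_fun (@continuous_sin R))
  (measurable_affine t k)).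
Qed.

Let measurable_cos_affine t k : measurable_fun setT (fun s => cos (t * phi s + k)).
Proof.
exact: (measurableT_comp (continuous_measurable_fun (@continuous_cos R))
  (measurable_affine t k)).
Qed.

Lemma bounded_measurable_horner_sin (q : {poly R}) w l t k :
  bounded_measurable (fun s => q.[sin (w * phi s + l)] * cos (t * phi s + k)).
Proof.
split.
  apply: measurable_funM => //.
  exact: (measurableT_comp (continuous_measurable_fun (@continuous_horner R q))
    (measurable_sin_affine w l)).
exists (\sum_(i < size q) `|q`_i|) => s; rewrite normrM -[leRHS]mulr1.
apply: ler_pM => //; last exact: cos_max.
rewrite horner_coef; apply: le_trans (ler_norm_sum _ _ _) _; apply: ler_sum => i _.
by rewrite normrM normrX ler_piMr// exprn_ile1// sin_max.
Qed.

(** Induction on the polynomial: each further factor [sin] is absorbed into the cosine, which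
    changes its frequency and shift. Hence [t] and [k] stay general in the induction. *)
Lemma pairing_horner_sin0 (q : {poly R}) w l t k :
  pairing g (fun s => q.[sin (w * phi s + l)] * cos (t * phi s + k)) = 0.
Proof.
elim/poly_ind: q t k => [|q c IH] t k.
  rewrite /pairing (_ : (fun s => _) = fun=> 0); 
    last by apply/funext => s; rewrite horner0 !mul0r.
  by rewrite Rintegral_cst// mul0r.
have bq := bounded_measurable_horner_sin q w l.
have bc := bounded_measurable_horner_sin 1 0 0.
(* Here [sin a * cos b = (sin (b + a) - sin (b - a)) / 2], with both sines rewritten as cosines
   shifted by [pi / 2]. *)
pose A s := q.[sin (w * phi s + l)] * cos ((t + w) * phi s + (k + l - pi / 2)).
pose B s := q.[sin (w * phi s + l)] * cos ((t - w) * phi s + (k - l + pi / 2)).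
pose C s := (1 : {poly R}).[sin (0 * phi s + 0)] * cos (t * phi s + k).
have -> : (fun s => (q * 'X + c%:P).[sin (w * phi s + l)] * cos (t * phi s + k))
   = fun s => (2^-1 * A s + 2^-1 * B s) + c * C s.
  apply/funext => s; rewrite /A /B /C hornerMXaddC hornerC.
  set a := w * phi s + l; set b := t * phi s + k.
  rewrite (_ : _ + (k + l - pi / 2) = (b + a) - pi / 2); last by rewrite /a /b; ring.
  rewrite (_ : _ + (k - l + pi / 2) = (b - a) + pi / 2); last by rewrite /a /b; ring.
  clearbody a b; by rewrite cosBpihalf cosDpihalf sinD sinB; field.
have bA : bounded_measurable A by exact: bq.
have bB : bounded_measurable B by exact: bq.
have bC : bounded_measurable C by exact: bc.
have bZA := bounded_measurableZ A 2^-1 bA.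
have bZB := bounded_measurableZ B 2^-1 bB.
have bZC := bounded_measurableZ C c bC.
apply: etrans; first exact: (pairingD _ _ _ ig (bounded_measurableD _ _ bZA bZB) bZC).
rewrite [X in X + _](pairingD _ _ _ ig bZA bZB) !pairingZ// !IH.
rewrite (_ : C = fun s => cos (t * phi s + k)) ?fourier0 ?mulr0 ?addr0//.
by apply/funext => s; rewrite /C hornerE mul1r.
Qed.

(* [sg (phi - y)] is a bounded pointwise limit of trigonometric polynomials in
   [phi]: iterate [smoothstep] on [sin (w * (phi - y))], then let [w] tend to [0]. *)
Lemma pairing_sg0 y : pairing g (fun s => Num.sg (phi s - y)) = 0.
Proof.
have msin w l : measurable_fun setT (fun s => Num.sg (sin (w * phi s + l))).
  exact: (measurableT_comp measurable_sg (measurable_sin_affine w l)).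
have sgsin0 w l : pairing g (fun s => Num.sg (sin (w * phi s + l))) = 0.
  apply: (@pairing_cvg0 _ _
      (fun n s => iter n smoothstep (sin (w * phi s + l)))) => //.
  - move=> n; under eq_fun do rewrite -horner_smoothstep_poly.
    exact: (measurableT_comp (continuous_measurable_fun (@continuous_horner R _))
      (measurable_sin_affine w l)).
  - by move=> n s; apply: iter_smoothstep_le1; exact: sin_max.
  - by move=> s; apply: iter_smoothstep_cvg; exact: sin_max.
  - move=> n; rewrite -(pairing_horner_sin0 (smoothstep_poly n) w l 0 0).
    congr pairing; apply/funext => s.
    by rewrite horner_smoothstep_poly mul0r addr0 cos0 mulr1.
apply: (@pairing_cvg0 _ _
    (fun n s => Num.sg (sin (n.+1%:R^-1 * phi s + (- (n.+1%:R^-1 * y)))))) => //.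
- under eq_fun do rewrite -[phi _]mul1r.
  exact: (measurableT_comp measurable_sg (measurable_affine 1 (- y))).
- by move=> n s; exact: sg_le1.
- by move=> s; under eq_fun do rewrite -mulrBr; exact: sg_sin_div_cvg.
Qed.

End FourierUniqueness.

(** * The primitive of [g] and its level sets *)

Section SignPrimitive.
Context {R : realType}.
Notation mu := (@lebesgue_measure R).
Variable g : R -> R.
Hypothesis ig : mu.-integrable setT (EFin \o g).
Hypothesis total0 : pairing g (cst 1) = 0.

(* Up to the total mass of [g], this is [-2] times the primitive of [g]. *)
Definition sg_primitive x : R := pairing g (fun s => Num.sg (s - x)).

Lemma measurable_sgB (x : R) : measurable_fun setT (fun s : R => Num.sg (s - x)).
Proof.
exact: (measurableT_comp measurable_sg
  (measurable_funB (@measurable_id _ _ setT) (measurable_cst x))).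
Qed.

Lemma bounded_measurable_sgB (x : R) : bounded_measurable (fun s : R => Num.sg (s - x)).
Proof. by split; [exact: measurable_sgB|exists 1 => s; exact: sg_le1]. Qed.

Lemma bounded_measurable1 : bounded_measurable (cst 1 : R -> R).
Proof. by split; [exact: measurable_cst|exists 1 => s; rewrite normr1]. Qed.

(** The sign of [phi - phi a] is [1 + sg (s - b) - sg (s - a)] at every [s], endpoints included.
    Pairing with [g] removes the constant, because the total mass is zero. *)
Lemma sg_primitive_fold (phi : R -> R) a b : a < b -> phi a = phi b ->
  (forall s, s < a -> phi a < phi s) -> (forall s, a < s < b -> phi s < phi a) ->
  (forall s, b < s -> phi a < phi s) ->
  pairing g (fun s => Num.sg (phi s - phi a)) = 0 ->
  sg_primitive a = sg_primitive b.
Proof.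
move=> ab eab la mab lb fold0.
have e : (fun s => Num.sg (phi s - phi a)) =
    fun s => (cst 1 s + Num.sg (s - b)) + (-1) * Num.sg (s - a).
  apply/funext => s /=; rewrite mulN1r.
  have [sa|as_|->] := ltgtP s a.
  - rewrite (gtr0_sg (x := _ - phi a)) ?subr_gt0 ?la//.
    by have sb := lt_trans sa ab; rewrite !ltr0_sg ?subr_lt0//; ring.
  - have [sb|bs|->] := ltgtP s b.
    + rewrite (ltr0_sg (x := _ - phi a)) ?subr_lt0 ?mab ?as_//.
      by rewrite (ltr0_sg (x := _ - b)) ?subr_lt0// gtr0_sg ?subr_gt0//; ring.
    + by rewrite !gtr0_sg ?subr_gt0 ?lb//; ring.
    + by rewrite -eab !subrr sgr0 gtr0_sg ?subr_gt0//; ring.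
  - by rewrite !subrr sgr0 ltr0_sg ?subr_lt0//; ring.
move: fold0; rewrite e.
have bb := bounded_measurable_sgB b.
have ba := bounded_measurableZ _ (-1) (bounded_measurable_sgB a).
have b1b := bounded_measurableD _ _ bounded_measurable1 bb.
rewrite (pairingD _ _ _ ig b1b ba).
rewrite [X in X + _](pairingD _ _ _ ig bounded_measurable1 bb) total0 add0r.
rewrite pairingZ//; last exact: bounded_measurable_sgB.
by rewrite mulN1r => /eqP; rewrite subr_eq0 => /eqP.
Qed.

(** Sequential continuity: the signs converge off the null set [{x}]. *)
Lemma sg_primitive_cvg (x_ : nat -> R) x : x_ n @[n --> \oo] --> x ->
  sg_primitive (x_ n) @[n --> \oo] --> sg_primitive x.
Proof.
move=> cx; apply: (@pairing_cvg _ _ (fun n s => Num.sg (s - x_ n))) => //.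
- exact: measurable_sgB.
- by move=> n; exact: measurable_sgB.
- by move=> n s; exact: sg_le1.
exists [set x]; split => //; first exact: lebesgue_measure_set1.
move=> s; apply: contra_notP => /eqP sx.
have cv : (s - x_ n) @[n --> \oo] --> s - x by apply: cvgB => //; exact: cvg_cst.
apply: cvg_near_cst; move: sx; rewrite -subr_eq0 neq_lt => /orP[sx|sx].
- near=> n; rewrite (ltr0_sg sx) ltr0_sg//; near: n; exact: (cvgr_lt _ cv).
- near=> n; rewrite (gtr0_sg sx) gtr0_sg//; near: n; exact: (cvgr_gt _ cv).
Unshelve. all: by end_near. Qed.

Lemma sg_primitive_cvg0 (x_ : nat -> R) : (forall n, n%:R < x_ n) ->
  sg_primitive (x_ n) @[n --> \oo] --> (0 : R).
Proof.
move=> xn.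
have -> : (0 : R) = pairing g (fun s => -1 * cst 1 s).
  by rewrite pairingZ ?total0 ?mulr0//; exact: bounded_measurable1.
apply: (@pairing_cvg _ _ (fun n s => Num.sg (s - x_ n))) => //.
- exact: (bounded_measurableZ _ (-1) bounded_measurable1).1.
- by move=> n; exact: measurable_sgB.
- by move=> n s; exact: sg_le1.
apply: aeW => s; apply: cvg_near_cst; near=> n.
rewrite mulr1 ltr0_sg// subr_lt0; apply: lt_trans (xn n).
near: n; exact: nbhs_infty_gtr.
Unshelve. all: by end_near. Qed.

(* The level set through [x] is closed and bounded above, yet has no largest
   element. *)
Lemma sg_primitive_eq0 x :
  (forall y, exists2 z, y < z & sg_primitive z = sg_primitive y) ->
  sg_primitive x = 0.
Proof.
move=> escape; apply: contrapT => /eqP c0.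
pose S := [set y | sg_primitive y = sg_primitive x].
have Sx : S x by [].
have [ubS|nubS] := pselect (has_ubound S); last first.
  (* An unbounded level set contains points tending to infinity, where the primitive tends to 0. *)
  have : forall n : nat, exists y, n%:R < y /\ S y.
    move=> n; apply: contrapT => nex; apply: nubS; exists n%:R => y Sy.
    by rewrite leNgt; apply/negP => ny; apply: nex; exists y.
  move=> /choice[x_ x_P].
  have := sg_primitive_cvg0 x_ (fun n => (x_P n).1).
  under eq_fun do rewrite (x_P _).2.
  move=> /(cvg_lim (@Rhausdorff R)); rewrite lim_cst => // e.
  by rewrite e eqxx in c0.
have supS : has_sup S by split => //; exists x.
have [z supz zS] := escape (sup S).
have : forall n : nat, exists y, sup S - n.+1%:R^-1 < y /\ S y.
  move=> n; have [|y Sy yS] := sup_adherent (eps := n.+1%:R^-1) _ supS.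
    by rewrite invr_gt0.
  by exists y.
move=> /choice[x_ x_P].
have cx : x_ n @[n --> \oo] --> sup S.
  have cv : (sup S - n.+1%:R^-1) @[n --> \oo] --> sup S.
    rewrite -[X in _ --> X]subr0; apply: cvgB; first exact: cvg_cst.
    exact: cvg_harmonic.
  have sq : \forall n \near \oo, sup S - n.+1%:R^-1 <= x_ n <= sup S.
    apply: nearW => n; rewrite (ltW (x_P n).1)/=.
    by apply: ub_le_sup => //; exact: (x_P n).2.
  by apply: (squeeze_cvgr sq cv); exact: cvg_cst.
(* By continuity the supremum lies in the level set, so [z], beyond it at the same level, is a
   contradiction. *)
have SsupS : S (sup S).
  have := sg_primitive_cvg _ _ cx.
  under eq_fun do rewrite (x_P _).2.
  by move=> /(cvg_lim (@Rhausdorff R)); rewrite lim_cst.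
have : z <= sup S by apply: ub_le_sup => //; rewrite /S/= zS.
by rewrite leNgt supz.
Qed.

Lemma sg_primitive_ae0 : (forall x, sg_primitive x = 0) ->
  {ae mu, forall s, g s = 0}.
Proof.
move=> G0.
have igA A : measurable A -> mu.-integrable A (EFin \o g).
  by move=> mA; apply: integrableS ig.
have F0 x : \int[mu]_(s in `]-oo, x]) g s = 0.
  have e1 := Rintegral_itv_bndo_bndc (igA _ (measurable_itv `]-oo, x[)).
  have b A : measurable A -> bounded_measurable (\1_A : R -> R).
    move=> mA; split; first exact: measurable_indic.
    by exists 1 => s; rewrite indicE; case: (_ \in _); rewrite ?normr1 ?normr0.
  have pE (A : set R) : measurable A -> \int[mu]_(s in A) g s = pairing g \1_A.
    move=> mA; rewrite Rintegral_mkcond /pairing; apply: eq_Rintegral => s _.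
    by rewrite patchE indicE; case: (_ \in _); rewrite ?mul1r ?mul0r.
  have bo := b _ (measurable_itv `]-oo, x[).
  have bc := b _ (measurable_itv `]-oo, x]).
  (* Adding the open and the closed half-line makes the identity exact at [s = x] too; both carry
     the same integral. *)
  have e2 : (fun s => \1_`]-oo, x[%classic s + \1_`]-oo, x]%classic s) =
      (fun s => cst 1 s + -1 * Num.sg (s - x)) :> (R -> R).
    apply/funext => s /=; rewrite !indicE !mem_setE !in_itv/= mulN1r.
    case: ltgtP => sx /=.
    - by rewrite ltr0_sg ?subr_lt0//; ring.
    - by rewrite gtr0_sg ?subr_gt0//; ring.
    - by rewrite sx subrr sgr0; ring.
  have := pairingD _ _ _ ig bo bc; rewrite e2.
  rewrite (pairingD _ _ _ ig bounded_measurable1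
    (bounded_measurableZ _ (-1) (bounded_measurable_sgB x))).
  rewrite total0 pairingZ//; last exact: bounded_measurable_sgB.
  rewrite [X in -1 * X]G0 -!pE// e1.
  by rewrite mulr0 addr0 => /eqP; rewrite eq_sym -mulr2n mulrn_eq0/= => /eqP.
(* Almost everywhere [g] is the derivative of its primitive, which is identically 0. *)
have := FTC1Ny (f := g) (fun y => igA _ (measurable_itv _))
  (open_integrable_locally openT ig).
apply: (@filterS _ _ (ae_filter_ringOfSetsType mu)) => s [_ <-].
rewrite (_ : (fun x => _) = cst 0); last by apply/funext.
by rewrite derive1_cst.
Qed.

End SignPrimitive.

(** * Unimodal functions *)

Section Unimodal.
Context {R : realType}.

Definition unimodal (f : R -> R) (m : R) :=
  (forall x y, x < y -> y <= m -> f y < f x) /\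
  (forall x y, m <= x -> x < y -> f x < f y).

Lemma unimodal_fold (f : R -> R) m a b : unimodal f m -> a < b -> f a = f b ->
  [/\ forall s, s < a -> f a < f s, forall s, a < s < b -> f s < f a &
      forall s, b < s -> f a < f s].
Proof.
move=> [decr incr] ab eab.
(* Equal values at [a < b] force the vertex strictly between them, by strict monotonicity on either
   side. *)
have am : a < m by rewrite ltNge; apply/negP => /incr/(_ ab); rewrite eab ltxx.
have mb : m < b by rewrite ltNge; apply/negP => /(decr _ _ ab); rewrite eab ltxx.
split=> [s sa|s /andP[as_ sb]|s bs].
- exact: decr (ltW am).
- by have [sm|ms] := leP s m; [exact: decr|rewrite eab; apply: incr => //; exact: ltW].
- by rewrite eab; apply: incr => //; exact: ltW.
Qed.

Lemma continuous_level (f : R -> R) a b v : continuous f -> a <= b ->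
  (f a <= v <= f b) || (f b <= v <= f a) -> exists2 c, a <= c <= b & f c = v.
Proof.
move=> cf ab fab; have [||c cab fc] := @IVT R f a b v ab.
- exact: continuous_subspaceT.
- have [ff|ff] := leP (f a) (f b); case/orP: fab => /andP[h1 h2]; apply/andP; split; lra.
- by exists c => //; move: cab; rewrite in_itv.
Qed.

End Unimodal.

(** * The phase: continuity, vertex and growth *)

Section Phase.
Context {R : realType}.
Variables (p c d : R).
Hypotheses (c_gt0 : 0 < c) (d_gt0 : 0 < d).

Definition phase (s : R) : R := c * s + d * gam p s.

(** Near 0, [|x|^p] is squeezed between 0 and [|x|], since [p >= 1]. *)
Lemma gam_cvg0 : 1 <= p -> gam p x @[x --> (0 : R)] --> (0 : R).
Proof.
move=> p1.
have sq : \forall x \near (0 : R), 0 <= gam p x <= `|x|.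
  near=> x; rewrite powR_ge0/=.
  have [->|x0] := eqVneq x 0.
    by rewrite /gam normr0 powR0// gt_eqF// (lt_le_trans ltr01).
  apply: ge1r_powR => //; rewrite normr_gt0 x0/=.
  near: x; exact: (@nbhs0_le _ R).
apply: (squeeze_cvgr sq); first exact: cvg_cst.
rewrite -[X in _ --> X](@normr0 _ R); exact: (@norm_continuous _ R).
Unshelve. all: by end_near. Qed.

Lemma continuous_gam : 1 <= p -> continuous (gam p : R -> R).
Proof.
move=> p1 x; have [->|x0] := eqVneq x 0.
  rewrite /continuous_at (_ : gam p 0 = 0); first exact: gam_cvg0.
  by rewrite /gam normr0 powR0// gt_eqF// (lt_le_trans ltr01).
apply: (@continuous_comp _ _ _ (fun x : R => `|x|) (fun x : R => x `^ p)).
  exact: (@norm_continuous _ R).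
apply: differentiable_continuous; apply/derivable1_diffP.
by apply: derivable_powR; rewrite in_itv/= andbT normr_gt0.
Qed.

Lemma continuous_phase : 1 <= p -> continuous phase.
Proof.
move=> p1 x; apply: cvgD; apply: cvgM; try exact: cvg_cst.
- exact: cvg_id.
- exact: continuous_gam.
Qed.

Lemma measurable_phase : 1 <= p -> measurable_fun setT phase.
Proof. by move=> p1; apply: continuous_measurable_fun; exact: continuous_phase. Qed.

(** The derivative is computed left of 0, where [|y| = - y]. On the right monotonicity is direct, as
    both terms of the phase are monotone there. *)
Lemma is_derive_phase (x : R) : x < 0 ->
  is_derive x 1 phase (c - d * (p * (- x) `^ (p - 1))).
Proof.
move=> x0.
have nx : \forall y \near x, c * y + d * (- y) `^ p = phase y.
  near=> y; rewrite /phase /gam ltr0_norm//.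
  by near: y; exact: lt_nbhsl.
apply: (near_eq_is_derive nx).
have x0' : 0 < - x by rewrite oppr_gt0.
have d1 := @is_derive1_powR R p _ x0'.
have d2 := @is_derive1_comp _ (fun y : R => y `^ p) -%R x _ _ d1 (is_deriveNid x 1).
have -> : c - d * (p * (- x) `^ (p - 1)) =
    c *: 1 + d *: ((p * (- x) `^ (p - 1)) * -1) by rewrite /GRing.scale/=; ring.
by apply: is_deriveD; apply: is_deriveZ.
Unshelve. all: by end_near. Qed.

(** For [p > 1], the zero of the derivative on the negative half-line, found by solving
    [c = d p (-s)^(p-1)]. *)
Definition vertex : R := - (c / (d * p)) `^ (p - 1)^-1.

Lemma powR_vertex : 1 < p -> c = d * (p * (- vertex) `^ (p - 1)).
Proof.
move=> p1; rewrite /vertex opprK -powRrM mulVf ?subr_eq0 ?gt_eqF// powRr1.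
  by field; rewrite !gt_eqF//=; lra.
by rewrite divr_ge0 ?mulr_ge0 ?ltW//; lra.
Qed.

Lemma vertex_lt0 : 1 < p -> vertex < 0.
Proof.
by move=> p1; rewrite oppr_lt0 powR_gt0// divr_gt0// mulr_gt0//; lra.
Qed.

Lemma phase_homo_ge0 (x y : R) : 1 < p -> 0 <= x -> x < y -> phase x < phase y.
Proof.
move=> p1 x0 xy; apply: ltr_leD; first by rewrite ltr_pM2l.
rewrite ler_pM2l// /gam !ger0_norm//; last by lra.
by apply: ge0_ler_powR => //; rewrite ?nnegrE; lra.
Qed.

(** Left of 0 the derivative is strictly increasing and vanishes at the vertex, so the mean value
    theorem gives the sign of each increment. An interval crossing 0 is split there. *)
Lemma unimodal_phase : 1 < p -> unimodal phase vertex.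
Proof.
move=> p1.
have p1' : 1 <= p by lra.
have v0 := vertex_lt0 p1.
have mvt x y : x < y -> y <= 0 -> exists2 z, x < z < y &
    phase y - phase x = (c - d * (p * (- z) `^ (p - 1))) * (y - x).
  move=> xy y0.
  have [||z zxy e] := @MVT R phase (fun z => c - d * (p * (- z) `^ (p - 1))) x y xy.
  - move=> z; rewrite in_itv/= => /andP[xz zy]; apply: is_derive_phase; lra.
  - by apply: continuous_subspaceT; exact: continuous_phase.
  - by exists z => //; move: zxy; rewrite in_itv.
have slope z w : z < w -> w <= 0 ->
    d * (p * (- w) `^ (p - 1)) < d * (p * (- z) `^ (p - 1)).
  move=> zw w0; rewrite ltr_pM2l// ltr_pM2l; last lra.
  by apply: gt0_ltr_powR; rewrite ?nnegrE; lra.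
split=> x y.
  move=> xy yv; have [|z /andP[xz zy] e] := mvt x y xy; first lra.
  rewrite -subr_lt0 e nmulr_rlt0 ?subr_gt0// subr_lt0 {1}powR_vertex//.
  by apply: slope; lra.
have incr_le0 a b : vertex <= a -> a < b -> b <= 0 -> phase a < phase b.
  move=> va ab b0; have [|z /andP[az zb] e] := mvt a b ab; first lra.
  rewrite -subr_gt0 e mulr_gt0 ?subr_gt0// {1}powR_vertex//.
  by apply: slope; lra.
move=> vx xy; have [x0|x0] := leP 0 x; first exact: phase_homo_ge0.
have [y0|y0] := leP y 0; first exact: incr_le0.
apply: (@lt_trans _ _ (phase 0)); first exact: incr_le0.
exact: phase_homo_ge0.
Qed.

Lemma phase_unbounded_right x v : exists2 z, x <= z & v <= phase z.
Proof.
(* The power term is nonnegative, so the phase at [z] is at least [c * z >= |v|]. *)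
pose z := `|x| + `|v| / c.
have q0 : 0 <= `|v| / c by rewrite divr_ge0// ltW.
have z0 : 0 <= z by rewrite addr_ge0.
exists z; first by rewrite (le_trans (ler_norm x))// lerDl.
apply: (@le_trans _ _ (c * z)); last by rewrite lerDl mulr_ge0 ?powR_ge0 ?ltW.
apply: le_trans (ler_norm v) _; rewrite mulrDr (mulrC c (_ / c)) divfK ?gt_eqF//.
by rewrite lerDr mulr_ge0// ltW.
Qed.

Lemma phase_unbounded_left x v : 1 < p -> exists2 z, z <= x & v <= phase z.
Proof.
(* At [-t] the phase is [t (d t^(p-1) - c)]. The radius [r] solves [d r^(p-1) = 2 c], so [t >= r]
   makes this at least [c * t], and the remaining summands of [t] give [c * t >= |v|] and
   [-t <= x]. *)
move=> p1; pose r := (2 * c / d) `^ (p - 1)^-1.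
pose t := r + (`|x| + `|v| / c).
have q0 : 0 <= `|v| / c by rewrite divr_ge0// ltW.
have r0 : 0 <= r by exact: powR_ge0.
have t0 : 0 <= t by rewrite !addr_ge0.
have xt : - t <= x by have := ler_norm (- x); rewrite normrN /t; lra.
exists (- t) => //.
rewrite /phase /gam normrN ger0_norm// -mulr_powRB1//; last lra.
have rE : d * r `^ (p - 1) = 2 * c.
  rewrite -powRrM mulVf ?subr_eq0 ?gt_eqF// powRr1.
    by field; rewrite gt_eqF.
  by rewrite divr_ge0 ?mulr_ge0 ?ltW.
have rt : d * r `^ (p - 1) <= d * t `^ (p - 1).
  rewrite ler_pM2l//; apply: ge0_ler_powR; rewrite ?nnegrE//; first lra.
  by rewrite lerDl addr_ge0.
have vt : v <= c * t.
  apply: le_trans (ler_norm v) _.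
  rewrite [leRHS]mulrC -ler_pdivrMr//.
  by have := normr_ge0 x; rewrite /t; lra.
apply: (le_trans vt); have : (2 * c) * t <= (d * t `^ (p - 1)) * t.
  by rewrite ler_wpM2r// -rE.
lra.
Qed.

End Phase.

(** * The increasing phase for [p = 1] and composed reflections for [p > 1] *)

(** The term [d * |s|] can drop by at most [d (y - x)], less than the gain [c (y - x)]. *)
Lemma phase1_homo {R : realType} (c d : R) : 0 < d < c ->
  {homo phase 1 c d : x y / x < y}.
Proof.
move=> /andP[d0 dc] x y xy; rewrite /phase /gam !powRr1// -subr_gt0.
have h : `|x| - `|y| <= y - x.
  rewrite (le_trans (lerB_dist _ _))// distrC ger0_norm//; lra.
have : d * (`|x| - `|y|) <= d * (y - x) by rewrite ler_pM2l.
have : d * (y - x) < c * (y - x) by rewrite ltr_pM2r// subr_gt0.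
lra.
Qed.

(* Reflecting [x] through the fold of the first phase and then through the fold
   of the second moves it to the right. *)
Lemma phase_escape {R : realType} (p c1 d1 c2 d2 : R) (G : R -> R) :
  1 < p -> 0 < c1 -> 0 < d1 -> 0 < c2 -> 0 < d2 -> d1 * c2 < d2 * c1 ->
  (forall a b, a < b -> phase p c1 d1 a = phase p c1 d1 b -> G a = G b) ->
  (forall a b, a < b -> phase p c2 d2 a = phase p c2 d2 b -> G a = G b) ->
  forall x, exists2 z, x < z & G z = G x.
Proof.
move=> p1 c10 d10 c20 d20 cd fold1 fold2 x.
have p1' : 1 <= p by lra.
set f1 := phase p c1 d1; set f2 := phase p c2 d2.
have cf1 : continuous f1 by exact: continuous_phase.
have cf2 : continuous f2 by exact: continuous_phase.
have [decr1 incr1] : unimodal f1 (vertex p c1 d1) by exact: unimodal_phase.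
have [decr2 incr2] : unimodal f2 (vertex p c2 d2) by exact: unimodal_phase.
(* The hypothesis says [c2 / d2 < c1 / d1]: the steeper line has its vertex further right. *)
have v12 : vertex p c1 d1 < vertex p c2 d2.
  rewrite ltrN2; apply: gt0_ltr_powR; rewrite ?nnegrE ?invr_gt0 ?subr_gt0//.
  - by rewrite divr_ge0 ?mulr_ge0//; lra.
  - by rewrite divr_ge0 ?mulr_ge0//; lra.
  - rewrite ltr_pdivrMr ?mulr_gt0//; last lra.
    rewrite mulrAC ltr_pdivlMr ?mulr_gt0//; last lra.
    by rewrite [ltLHS](_ : _ = p * (d1 * c2)) 1?[ltRHS](_ : _ = p * (d2 * c1));
      [rewrite ltr_pM2l//; lra|ring|ring].
have reach w : x < w -> f2 w <= f2 x -> exists2 z, w <= z & f2 z = f2 x.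
  move=> xw f2w.
  have [z wz f2z] := phase_unbounded_right p c2 d2 c20 d20 w (f2 x).
  have [|y /andP[wy _] e] := @continuous_level _ f2 w z (f2 x) cf2 wz.
    by rewrite f2w f2z.
  by exists y.
(* Left of the second vertex, the second reflection alone moves [x] to the right. *)
have [xv|vx] := ltP x (vertex p c2 d2).
  have [z vz e] := reach _ xv (ltW (decr2 _ _ xv (lexx _))).
  exists z; first exact: lt_le_trans vz.
  by apply/esym/fold2 => //; exact: lt_le_trans vz.
have v1x := lt_le_trans v12 vx.
(* Otherwise [x] is right of the first vertex, and [y] is its mirror image under the first fold. *)
have [y yx e1] : exists2 y, y < x & f1 y = f1 x.
  have [w wv f1w] := phase_unbounded_left p c1 d1 c10 d10 (vertex p c1 d1) (f1 x) p1.
  have [|y /andP[_ yv] e] := @continuous_level _ f1 w _ (f1 x) cf1 wv.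
    by rewrite f1w (ltW (incr1 _ _ (lexx _) v1x)) orbT.
  by exists y => //; exact: le_lt_trans v1x.
(* Eliminating the power term through [f1 y = f1 x] gives [f2 y - f2 x = (d2 c1 - d1 c2) (x - y) /
   d1 > 0]. The second fold therefore sends [y] beyond [x]. *)
have f2y : f2 x < f2 y.
  have e1' : c1 * (x - y) = d1 * (gam p y - gam p x).
    by move: e1; rewrite /f1 /phase; lra.
  have xy0 : 0 < x - y by lra.
  rewrite /f2 /phase -subr_gt0.
  have -> : c2 * y + d2 * gam p y - (c2 * x + d2 * gam p x) =
      (d2 * (d1 * (gam p y - gam p x)) - d1 * c2 * (x - y)) / d1.
    by field; rewrite gt_eqF.
  rewrite -e1' divr_gt0//.
  have -> : d2 * (c1 * (x - y)) - d1 * c2 * (x - y) = (d2 * c1 - d1 * c2) * (x - y).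
    by ring.
  by rewrite mulr_gt0// subr_gt0.
have [z0 xz0 f2z0] := phase_unbounded_right p c2 d2 c20 d20 x (f2 y).
have [|z /andP[xz _] e2] := @continuous_level _ f2 x z0 (f2 y) cf2 xz0.
  by rewrite (ltW f2y) f2z0.
have {}xz : x < z.
  by rewrite lt_neqAle xz andbT; apply/eqP => xz'; rewrite -e2 xz' ltxx in f2y.
exists z => //; rewrite -(fold1 _ _ yx e1); apply/esym/fold2; first exact: lt_trans xz.
by rewrite [RHS]e2.
Qed.

(** * Uniqueness for densities on two lines *)

Section Density.
Context {R : realType}.
Notation mu := (@lebesgue_measure R).

Lemma arcw_gt0 (p s : R) : 0 < arcw p s.
Proof. by rewrite sqrtr_gt0 ltr_pwDl// sqr_ge0. Qed.

(* Adding and subtracting the transforms at [t] and [-t] separates the real and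
   imaginary parts of the density. *)
Lemma FT_zero_pairing (p c d : R) (u v : R -> R) : 1 <= p ->
  AC_density p u v -> (forall t, FT_zero p u v (t * c) (t * d)) ->
  forall t k,
    pairing (fun s => u s * arcw p s) (fun s => cos (t * phase p c d s + k)) = 0 /\
    pairing (fun s => v s * arcw p s) (fun s => cos (t * phase p c d s + k)) = 0.
Proof.
move=> p1 [iu iv] ft0.
set a := fun s => u s * arcw p s; set b := fun s => v s * arcw p s.
pose f := phase p c d.
have mf t : measurable_fun setT (fun s => t * f s).
  exact: (measurable_funM (measurable_cst t) (measurable_phase p c d p1)).
have bcos t : bounded_measurable (fun s => cos (t * f s)).
  split; last by exists 1 => s; exact: cos_max.
  exact: (measurableT_comp (continuous_measurable_fun (@continuous_cos R)) (mf t)).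
have bsin t : bounded_measurable (fun s => sin (t * f s)).
  split; last by exists 1 => s; exact: sin_max.
  exact: (measurableT_comp (continuous_measurable_fun (@continuous_sin R)) (mf t)).
pose C h t := pairing h (fun s => cos (t * f s)).
pose S h t := pairing h (fun s => sin (t * f s)).
have tf t s : t * c * s + t * d * gam p s = t * f s by rewrite /f /phase; ring.
have reE t : FT_re p u v (t * c) (t * d) = C a t + S b t.
  rewrite /C /S /pairing -RintegralD//; try exact: integrable_pairing.
  by apply: eq_Rintegral => s _; rewrite tf /a /b; ring.
have imE t : FT_im p u v (t * c) (t * d) = C b t - S a t.
  rewrite /C /S /pairing -RintegralB//; try exact: integrable_pairing.
  by apply: eq_Rintegral => s _; rewrite tf /a /b; ring.
have CN h t : C h (- t) = C h t.
  by congr pairing; apply/funext => s; rewrite mulNr cosN.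
have SN h t : mu.-integrable setT (EFin \o h) -> S h (- t) = - S h t.
  move=> ih; rewrite /S -[RHS]mulN1r -(pairingZ _ _ _ ih (bsin t)).
  by congr pairing; apply/funext => s; rewrite mulNr sinN mulN1r.
have cosE h t k : mu.-integrable setT (EFin \o h) ->
    pairing h (fun s => cos (t * f s + k)) = cos k * C h t + (- sin k) * S h t.
  move=> ih; rewrite /C /S -(pairingZ _ _ _ ih (bcos t)) -(pairingZ _ _ _ ih (bsin t)).
  rewrite -(pairingD _ _ _ ih (bounded_measurableZ _ _ (bcos t))
    (bounded_measurableZ _ _ (bsin t))).
  by congr pairing; apply/funext => s; rewrite cosD; ring.
move=> t k; rewrite !cosE//.
have [] := ft0 t; rewrite reE imE => e1 e2.
have [] := ft0 (- t); rewrite reE imE !CN !SN// => e3 e4.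
have -> : C a t = 0 by lra.
have -> : C b t = 0 by lra.
have -> : S a t = 0 by lra.
have -> : S b t = 0 by lra.
by rewrite !mulr0 addr0.
Qed.

(** For [p = 1], [d1 < c1] makes the first phase increasing; for [p > 1], [d1 * c2 < d2 * c1]
    separates the two vertices. *)
Lemma two_phases_ae0 (p c1 d1 c2 d2 : R) (g : R -> R) :
  1 <= p -> 0 < d1 < c1 -> 0 < c2 -> 0 < d2 -> d1 * c2 < d2 * c1 ->
  mu.-integrable setT (EFin \o g) ->
  (forall t k, pairing g (fun s => cos (t * phase p c1 d1 s + k)) = 0) ->
  (forall t k, pairing g (fun s => cos (t * phase p c2 d2 s + k)) = 0) ->
  {ae mu, forall s, g s = 0}.
Proof.
move=> p1 dc1 c20 d20 cd ig ft1 ft2.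
have /andP[d10 dc] := dc1; have c10 := lt_trans d10 dc.
(* The total mass is the transform at frequency 0. *)
have total0 : pairing g (cst 1) = 0.
  rewrite -(ft1 0 0); congr pairing; apply/funext => s.
  by rewrite mul0r addr0 cos0.
have sg1 := pairing_sg0 _ _ ig (measurable_phase p c1 d1 p1) ft1.
have sg2 := pairing_sg0 _ _ ig (measurable_phase p c2 d2 p1) ft2.
apply: sg_primitive_ae0 => // x.
move: p1; rewrite le_eqVlt => /predU1P[pE|p1].
  (* An increasing phase preserves signs of differences, so the sign primitive itself is one of the
     vanishing pairings. *)
  rewrite -(sg1 (phase p c1 d1 x)); congr pairing; apply/funext => s.
  have incr : {homo phase p c1 d1 : x y / x < y} by rewrite -pE; exact: phase1_homo.
  have [sx|xs|->] := ltgtP s x; last by rewrite !subrr.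
  - by rewrite !ltr0_sg ?subr_lt0 ?incr.
  - by rewrite !gtr0_sg ?subr_gt0 ?incr.
have fold c d : 0 < c -> 0 < d ->
    (forall y, pairing g (fun s => Num.sg (phase p c d s - y)) = 0) ->
    forall a b, a < b -> phase p c d a = phase p c d b ->
    sg_primitive g a = sg_primitive g b.
  move=> c0 d0 sg0 a b ab eab.
  have [h1 h2 h3] := unimodal_fold _ _ _ _ (unimodal_phase p c d c0 d0 p1) ab eab.
  exact: (sg_primitive_fold g ig total0 (phase p c d)).
apply: sg_primitive_eq0 => // y.
exact: (phase_escape p c1 d1 c2 d2 _ p1 c10 d10 c20 d20 cd
  (fold _ _ c10 d10 sg1) (fold _ _ c20 d20 sg2)).
Qed.

(** The bound [th1 < pi / 4] yields [sin th1 < cos th1], and [th1 < th2] yields the cross inequality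
    through [sin (th2 - th1) > 0]. *)
Lemma HUP_two_lines (p th1 th2 : R) : 1 <= p ->
  0 < th1 < pi / 4 -> th1 < th2 < pi / 2 -> HUP_Gamma p (two_lines th1 th2).
Proof.
move=> p1 /andP[a0 a4] /andP[ab b2] u v AC ft0.
have pi0 := @pi_gt0 R.
have c10 : 0 < cos th1 by apply: cos_gt0_pihalf; apply/andP; split; lra.
have c20 : 0 < cos th2 by apply: cos_gt0_pihalf; apply/andP; split; lra.
have d10 : 0 < sin th1 by apply: sin_gt0_pihalf; apply/andP; split; lra.
have d20 : 0 < sin th2 by apply: sin_gt0_pihalf; apply/andP; split; lra.
have dc : sin th1 < cos th1.
  rewrite (_ : cos th1 = sin (pi / 2 - th1)); last first.
    by rewrite sinB sin_pihalf cos_pihalf; ring.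
  by rewrite ltr_sin ?in_itv/=; lra.
have cd : sin th1 * cos th2 < sin th2 * cos th1.
  have : 0 < sin (th2 - th1) by apply: sin_gt0_pihalf; apply/andP; split; lra.
  by rewrite sinB subr_gt0 [X in X < _]mulrC.
have [iu iv] := AC.
have ft1 t : FT_zero p u v (t * cos th1) (t * sin th1).
  by apply: (ft0 (t * cos th1, t * sin th1)); exists t; left.
have ft2 t : FT_zero p u v (t * cos th2) (t * sin th2).
  by apply: (ft0 (t * cos th2, t * sin th2)); exists t; right.
have P1 := FT_zero_pairing p _ _ u v p1 AC ft1.
have P2 := FT_zero_pairing p _ _ u v p1 AC ft2.
have dc1 : 0 < sin th1 < cos th1 by rewrite d10.
have aeu := two_phases_ae0 p _ _ _ _ _ p1 dc1 c20 d20 cd iu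
  (fun t k => (P1 t k).1) (fun t k => (P2 t k).1).
have aev := two_phases_ae0 p _ _ _ _ _ p1 dc1 c20 d20 cd iv
  (fun t k => (P1 t k).2) (fun t k => (P2 t k).2).
apply: (@filterS2 _ _ (ae_filter_ringOfSetsType mu) _ _ _ _ aeu aev) => s /eqP us /eqP vs.
(* The arc-length weight is positive and cancels. *)
by move: us vs; rewrite !mulf_eq0 !(gt_eqF (arcw_gt0 _ _)) !orbF => /eqP -> /eqP ->.
Qed.

End Density.

(** * A set of angles of positive measure *)

Theorem theorem3p4 (R : realType) (p : R) (hp : 1 <= p) :
  exists E : set (R * R),
    E `<=` [set xy : R * R | (- (pi / 2) <= xy.1 < pi / 2) /\ (- (pi / 2) <= xy.2 < pi / 2)] /\
    measurable E /\
    (0%E < product_measure1 (@lebesgue_measure R) (@lebesgue_measure R) E)%E /\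
    (forall th1 th2, E (th1, th2) -> HUP_Gamma p (two_lines th1 th2)).
Proof.
have pi0 := @pi_gt0 R.
(* The cut at [pi / 8] forces [th1 < th2], and the product form gives the measure as a product of
   two positive lengths. *)
exists (`]0, pi / 8[%classic `*` `]pi / 8, pi / 4[%classic); split; [|split; [|split]].
- move=> [x y] [/=]; rewrite !in_itv/= => /andP[x0 x1] /andP[y0 y1].
  by split; apply/andP; split; lra.
- by apply: measurableX.
- have itv_gt0 (a b : R) : a < b -> (0 < @lebesgue_measure R `]a, b[%classic)%E.
    by move=> ab; rewrite lebesgue_measure_itv/= lte_fin ab -EFinD lte_fin subr_gt0.
  by rewrite product_measure1E//; apply: mule_gt0; apply: itv_gt0; lra.
- move=> x y [/=]; rewrite !in_itv/= => /andP[x0 x1] /andP[y0 y1].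
  by apply: HUP_two_lines => //; apply/andP; split; lra.
Qed.
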